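(* Let $\mathcal{A}$ and $\mathcal{B}$ be triangulated categories and let $F:\mathcal{A}\to\mathcal{B}$ be a fully faithful exact functor. Suppose that $\mathcal{B}$ is indecomposable, and that not every object of $\mathcal{A}$ is isomorphic to $0$. Then $F$ is an equivalence of categories if, and only if, $F$ has a left adjoint $G$ and a right adjoint $H$ such that for any object $b$ of $\mathcal{B}$, $$Hb\cong 0\implies Gb\cong 0.$$
   Context: For objects $a,b$ of a triangulated category $\mathcal{A}$ with translation functor $T$, put $\operatorname{Hom}^i_{\mathcal{A}}(a,b)=\operatorname{Hom}_{\mathcal{A}}(a,T^ib)$ for $i\in\mathbb{Z}$. A triangulated category $\mathcal{A}$ is called indecomposable if whenever $\mathcal{A}_1$ and $\mathcal{A}_2$ are full subcategories of $\mathcal{A}$ satisfying (a) for every object $a$ of $\mathcal{A}$ there exist objects $a_j\in\operatorname{Ob}(\mathcal{A}_j)$ ($j=1,2$) such that $a$ is a biproduct of $a_1$ and $a_2$, and (b) for any pair of objects $a_j\in\operatorname{Ob}(\mathcal{A}_j)$ ($j=1,2$), $\operatorname{Hom}^i_{\mathcal{A}}(a_1,a_2)=\operatorname{Hom}^i_{\mathcal{A}}(a_2,a_1)=0$ for all $i\in\mathbb{Z}$, then there exists $j\in\{1,2\}$ such that $a\cong 0$ for all $a\in\operatorname{Ob}(\mathcal{A}_j)$. *)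

(* Defs.v *)
From HB Require Import structures.
From mathcomp Require Import all_boot all_order all_algebra.

Set Implicit Arguments.
Unset Strict Implicit.
Unset Printing Implicit Defensive.

Import GRing.Theory.
Local Open Scope ring_scope.

(* Every category below is preadditive, so the hom-sets carry their abelian
   group structure from the start.  The purely categorical notions (functor,
   isomorphism, equivalence, adjunction) do not use the addition; in particular
   a [functor] is not assumed to be additive.  The choiceType structure that is
   part of a zmodType exists on every type by the classical axioms. *)
Record preadditive := Preadditive {
  ob :> Type;
  hom : ob -> ob -> zmodType;
  idm : forall a : ob, hom a a;
  compm : forall a b c : ob, hom b c -> hom a b -> hom a c;
  compA : forall (a b c d : ob) (h : hom c d) (g : hom b c) (f : hom a b),
    compm h (compm g f) = compm (compm h g) f;
  comp1m : forall (a b : ob) (f : hom a b), compm (idm b) f = f;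
  compm1 : forall (a b : ob) (f : hom a b), compm f (idm a) = f;
  compDl : forall (a b c : ob) (g g' : hom b c) (f : hom a b),
    compm (g + g') f = compm g f + compm g' f;
  compDr : forall (a b c : ob) (g : hom b c) (f f' : hom a b),
    compm g (f + f') = compm g f + compm g f'
}.

Arguments hom {_} _ _.
Arguments idm {_} _.
Arguments compm {_} {_ _ _} _ _.

Declare Scope cat_scope.
Delimit Scope cat_scope with cat.
Notation "g \oc f" := (compm g f) (at level 40, left associativity) : cat_scope.
Local Open Scope cat_scope.

Section Objects.
Variable C : preadditive.

Definition is_iso (a b : C) (f : hom a b) : Prop :=
  exists g : hom b a, g \oc f = idm a /\ f \oc g = idm b.

Definition isomorphic (a b : C) : Prop := exists f : hom a b, is_iso f.

(* Initial and terminal: hom-sets always contain 0. *)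
Definition zero_object (z : C) : Prop :=
  (forall (a : C) (f : hom z a), f = 0) /\ (forall (a : C) (f : hom a z), f = 0).

Definition biproduct (a a1 a2 : C) : Prop :=
  exists (i1 : hom a1 a) (i2 : hom a2 a) (p1 : hom a a1) (p2 : hom a a2),
    [/\ p1 \oc i1 = idm a1, p2 \oc i2 = idm a2, p2 \oc i1 = 0, p1 \oc i2 = 0
      & i1 \oc p1 + i2 \oc p2 = idm a].

End Objects.

Record functor (C D : preadditive) := Functor {
  fob :> C -> D;
  fmap : forall a b : C, hom a b -> hom (fob a) (fob b);
  fmap1 : forall a : C, fmap (idm a) = idm (fob a);
  fmapM : forall (a b c : C) (g : hom b c) (f : hom a b),
    fmap (g \oc f) = fmap g \oc fmap f
}.

Arguments fmap {_ _} _ {_ _} _.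

Definition id_functor (C : preadditive) : functor C C :=
  @Functor C C (fun a => a) (fun _ _ f => f)
    (fun=> erefl) (fun _ _ _ _ _ => erefl).

Lemma comp_fmap1 (C D E : preadditive) (G : functor D E) (F : functor C D)
    (a : C) : fmap G (fmap F (idm a)) = idm (G (F a)).
Proof. by rewrite !fmap1. Qed.

Lemma comp_fmapM (C D E : preadditive) (G : functor D E) (F : functor C D)
    (a b c : C) (g : hom b c) (f : hom a b) :
  fmap G (fmap F (g \oc f)) = fmap G (fmap F g) \oc fmap G (fmap F f).
Proof. by rewrite !fmapM. Qed.

Definition comp_functor (C D E : preadditive)
    (G : functor D E) (F : functor C D) : functor C E :=
  @Functor C E (fun a => G (F a)) (fun _ _ f => fmap G (fmap F f))
    (comp_fmap1 G F) (comp_fmapM G F).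

Section Functors.
Variables C D : preadditive.

Definition is_natural_iso (F G : functor C D)
    (eta : forall a : C, hom (F a) (G a)) : Prop :=
  (forall (a b : C) (f : hom a b), eta b \oc fmap F f = fmap G f \oc eta a) /\
  (forall a : C, is_iso (eta a)).

Definition naturally_isomorphic (F G : functor C D) : Prop :=
  exists eta : forall a : C, hom (F a) (G a), is_natural_iso eta.

Definition additive_functor (F : functor C D) : Prop :=
  forall (a b : C) (f g : hom a b), fmap F (f + g) = fmap F f + fmap F g.

Definition fully_faithful (F : functor C D) : Prop :=
  forall a b : C, bijective (fun f : hom a b => fmap F f).

End Functors.

Definition quasi_inverse (C D : preadditive)
    (F : functor C D) (G : functor D C) : Prop :=
  naturally_isomorphic (comp_functor G F) (id_functor C) /\
  naturally_isomorphic (comp_functor F G) (id_functor D).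

Definition is_equivalence (C D : preadditive) (F : functor C D) : Prop :=
  exists G : functor D C, quasi_inverse F G.

(* [adjoint L R]: L is left adjoint to R. *)
Definition adjoint (C D : preadditive)
    (L : functor C D) (R : functor D C) : Prop :=
  exists phi : forall (c : C) (d : D), hom (L c) d -> hom c (R d),
    (forall c d, bijective (phi c d)) /\
    (forall (c c' : C) (d d' : D) (u : hom c' c) (v : hom d d')
       (f : hom (L c) d),
       phi c' d' (v \oc f \oc fmap L u) = fmap R v \oc phi c d f \oc u).

(* The translation [shift] is an additive autoequivalence with a chosen
   quasi-inverse [shiftV]; the convention that it is a strict automorphism is
   the case where both composites are identity functors.
   [dist f g h]: the triangle a -f-> b -g-> c -h-> shift a is distinguished. *)
Record triangulated := Triangulated {
  tcat :> preadditive;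
  zero : tcat;
  zeroP : zero_object zero;
  has_biproducts : forall a1 a2 : tcat, exists a : tcat, biproduct a a1 a2;
  shift : functor tcat tcat;
  shiftV : functor tcat tcat;
  shift_additive : additive_functor shift;
  shift_autoequivalence : quasi_inverse shift shiftV;
  dist : forall a b c : tcat, hom a b -> hom b c -> hom c (shift a) -> Prop;
  (* TR1 *)
  dist_id : forall a : tcat,
    dist (idm a) (0 : hom a zero) (0 : hom zero (shift a));
  dist_complete : forall (a b : tcat) (f : hom a b),
    exists (c : tcat) (g : hom b c) (h : hom c (shift a)), dist f g h;
  dist_iso : forall (a b c a' b' c' : tcat)
    (f : hom a b) (g : hom b c) (h : hom c (shift a))
    (f' : hom a' b') (g' : hom b' c') (h' : hom c' (shift a'))
    (u : hom a a') (v : hom b b') (w : hom c c'),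
    is_iso u -> is_iso v -> is_iso w ->
    v \oc f = f' \oc u -> w \oc g = g' \oc v -> fmap shift u \oc h = h' \oc w ->
    dist f g h -> dist f' g' h';
  (* TR2 *)
  dist_rotate : forall (a b c : tcat)
    (f : hom a b) (g : hom b c) (h : hom c (shift a)),
    dist f g h <-> dist g h (- fmap shift f);
  (* TR3 *)
  dist_morphism : forall (a b c a' b' c' : tcat)
    (f : hom a b) (g : hom b c) (h : hom c (shift a))
    (f' : hom a' b') (g' : hom b' c') (h' : hom c' (shift a'))
    (u : hom a a') (v : hom b b'),
    dist f g h -> dist f' g' h' -> v \oc f = f' \oc u ->
    exists w : hom c c', w \oc g = g' \oc v /\ fmap shift u \oc h = h' \oc w;
  (* TR4, the octahedral axiom: cf, cg and cgf are the cones of f, g and g f *)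
  dist_octahedron : forall (a b c cf cg cgf : tcat)
    (f : hom a b) (u : hom b cf) (u' : hom cf (shift a))
    (g : hom b c) (v : hom c cg) (v' : hom cg (shift b))
    (w : hom c cgf) (w' : hom cgf (shift a)),
    dist f u u' -> dist g v v' -> dist (g \oc f) w w' ->
    exists (s : hom cf cgf) (t : hom cgf cg),
      [/\ dist s t (fmap shift u \oc v'),
          s \oc u = w \oc g, w' \oc s = u',
          t \oc w = v & v' \oc t = fmap shift f \oc w']
}.

Arguments zero {_}.
Arguments shift {_}.
Arguments shiftV {_}.
Arguments dist {_} {_ _ _} _ _ _.

Definition shiftz (A : triangulated) (i : int) (a : A) : A :=
  match i with
  | Posz n => iter n (fob shift) a
  | Negz n => iter n.+1 (fob shiftV) a
  end.

Definition homi (A : triangulated) (i : int) (a b : A) : zmodType :=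
  hom a (shiftz i b).

Definition exact_functor (A B : triangulated) (F : functor A B) : Prop :=
  additive_functor F /\
  exists alpha : forall a : A, hom (F (shift a)) (shift (F a)),
    @is_natural_iso A B (comp_functor F shift) (comp_functor shift F) alpha /\
    (forall (a b c : A) (f : hom a b) (g : hom b c) (h : hom c (shift a)),
       dist f g h -> dist (fmap F f) (fmap F g) (alpha a \oc fmap F h)).

(* A full subcategory is given by its class of objects, which is not required
   to be closed under isomorphism. *)
Definition indecomposable (A : triangulated) : Prop :=
  forall A1 A2 : A -> Prop,
    (forall a : A, exists a1 a2 : A, [/\ A1 a1, A2 a2 & biproduct a a1 a2]) ->
    (forall a1 a2 : A, A1 a1 -> A2 a2 -> forall i : int,
       (forall f : homi i a1 a2, f = 0) /\ (forall f : homi i a2 a1, f = 0)) ->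
    (forall a : A, A1 a -> isomorphic a zero) \/
    (forall a : A, A2 a -> isomorphic a zero).

(* Main.v *)
From mathcomp Require Import all_boot all_order all_algebra.
Require Import Defs.

Set Implicit Arguments.
Unset Strict Implicit.
Unset Printing Implicit Defensive.

Import GRing.Theory.
Local Open Scope ring_scope.
Local Open Scope cat_scope.

(** A fully faithful functor [F] with a natural isomorphism [F Q -> id] is an
    equivalence, and [Q] is then adjoint to [F] on both sides; this gives the
    direct implication, with [G = H = Q].

    Conversely, let [G] and [H] be the adjoints of [F], and complete the counit
    of [F] and [H] at [b] to a distinguished triangle

      [F (H b) -> b -> c -> shift (F (H b))].

    Maps from an object [F a] into [F (H b)] and into [b] are both the same as
    maps [a -> H b], by full faithfulness and by adjunction, and likewise in
    every degree because [F] commutes with the translation.  So the long exact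
    sequence of [hom (F a) -] shows that there
    are no nonzero maps from any [F a] to [c] ([cone_counit_right_orthogonal]).
    Hence [H c] is zero, and by hypothesis so is [G c], which says that there
    are no nonzero maps from [c] to any [F a] either.  The last map of the
    triangle is such a map, because the essential image of [F] is stable under
    the translation; so the triangle splits and [b] is a biproduct of [F (H b)]
    and [c] ([split_triangle]).

    Therefore the essential image of [F] and its right orthogonal satisfy the
    two conditions in the definition of indecomposability, and one of them
    consists of zero objects.  The essential image does not, since [F] is
    faithful and its source is nonzero.  So every [c] above is zero, every
    counit is an isomorphism, and [F] is an equivalence. *)

(** * Preadditive categories *)

Section Preadditive.
Variable C : preadditive.
Implicit Types a b c d : C.

Lemma comp0m a b c (f : hom a b) : (0 : hom b c) \oc f = 0.
Proof. by apply: (addIr (0 \oc f)); rewrite -compDl !add0r. Qed.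

Lemma compm0 a b c (g : hom b c) : g \oc (0 : hom a b) = 0.
Proof. by apply: (addIr (g \oc 0)); rewrite -compDr !add0r. Qed.

Lemma compNm a b c (g : hom b c) (f : hom a b) : (- g) \oc f = - (g \oc f).
Proof. by apply: (addIr (g \oc f)); rewrite -compDl !addNr comp0m. Qed.

Lemma compmN a b c (g : hom b c) (f : hom a b) : g \oc (- f) = - (g \oc f).
Proof. by apply: (addIr (g \oc f)); rewrite -compDr !addNr compm0. Qed.

Lemma null_source a b (f : hom a b) : idm a = 0 -> f = 0.
Proof. by move=> a0; rewrite -(compm1 f) a0 compm0. Qed.

Lemma isomorphic_sym a b : isomorphic a b -> isomorphic b a.
Proof. by case=> f [g [gf fg]]; exists g; exists f. Qed.

Lemma isomorphic_trans a b c :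
  isomorphic a b -> isomorphic b c -> isomorphic a c.
Proof.
case=> f [f' [f'f ff']] [g [g' [g'g gg']]]; exists (g \oc f), (f' \oc g').
split.
  by rewrite compA -(compA f') g'g compm1.
by rewrite compA -(compA g) ff' compm1.
Qed.

Lemma iso_compI a b c (f : hom a b) (u v : hom b c) :
  is_iso f -> u \oc f = v \oc f -> u = v.
Proof.
by case=> g [_ fg] /(congr1 (fun w => w \oc g)); rewrite -!compA fg !compm1.
Qed.

Lemma iso_Icomp a b c (f : hom b c) (u v : hom a b) :
  is_iso f -> f \oc u = f \oc v -> u = v.
Proof.
by case=> g [gf _] /(congr1 (fun w => g \oc w)); rewrite !compA gf !comp1m.
Qed.

Lemma inv_subproof a b (f : hom a b) :
  is_iso f -> exists g : hom b a, (g \oc f == idm a) && (f \oc g == idm b).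
Proof. by case=> g [gf fg]; exists g; rewrite gf fg !eqxx. Qed.

Definition inv a b (f : hom a b) (f_iso : is_iso f) : hom b a :=
  xchoose (inv_subproof f_iso).

Lemma inv_comp a b (f : hom a b) (f_iso : is_iso f) : inv f_iso \oc f = idm a.
Proof. by case/andP: (xchooseP (inv_subproof f_iso)) => /eqP. Qed.

Lemma comp_inv a b (f : hom a b) (f_iso : is_iso f) : f \oc inv f_iso = idm b.
Proof. by case/andP: (xchooseP (inv_subproof f_iso)) => _ /eqP. Qed.

End Preadditive.

Lemma isomorphic_zero (A : triangulated) (a : A) :
  isomorphic a zero <-> idm a = 0.
Proof.
have [z0 _] := zeroP A; split=> [[f [g [<- _]]]|a0].
  by rewrite (z0 _ g) comp0m.
exists 0, 0; split; first by rewrite comp0m.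
by rewrite comp0m (z0 _ (idm _)).
Qed.

(** * Functors, equivalences and adjunctions *)

Lemma retraction_faithful (C D : preadditive)
    (F : functor C D) (G : functor D C) (a b : C) :
  naturally_isomorphic (comp_functor G F) (id_functor C) ->
  injective (fun f : hom a b => fmap F f).
Proof.
case=> eta [eta_nat eta_iso] f g Ffg; apply: (iso_compI (eta_iso a)).
by rewrite -[f]/(fmap (id_functor C) f) -[g]/(fmap (id_functor C) g)
           -!eta_nat /= Ffg.
Qed.

Section FunctorTheory.
Variables C D : preadditive.

Lemma fmap_isomorphic (F : functor C D) (a b : C) :
  isomorphic a b -> isomorphic (F a) (F b).
Proof.
by case=> f [g [gf fg]]; exists (fmap F f), (fmap F g);
   rewrite -!fmapM gf fg !fmap1.
Qed.

Lemma additive_functor0 (F : functor C D) (a b : C) :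
  additive_functor F -> fmap F (0 : hom a b) = 0.
Proof. by move=> Fadd; apply: (addIr (fmap F 0)); rewrite -Fadd !add0r. Qed.

(** Both functors are faithful.  A preimage of [u] is the map [f] that
    naturality of [eta : G F -> id] forces, and [F f = u] because [G] sends both
    sides to the same map. *)
Lemma quasi_inverse_fully_faithful (F : functor C D) (G : functor D C) :
  quasi_inverse F G -> fully_faithful F.
Proof.
move=> [GF1 FG1] a b; have Finj := retraction_faithful (a := a) (b := b) GF1.
case: (GF1) => eta [eta_nat eta_iso].
pose pre u := eta b \oc fmap G u \oc inv (eta_iso a).
have preK : cancel pre (fun f : hom a b => fmap F f).
  move=> u; apply: (retraction_faithful FG1); apply: (iso_Icomp (eta_iso b)).
  rewrite [LHS](eta_nat _ _ (pre u)) /= /pre -!compA.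
  by rewrite inv_comp compm1.
by exists pre => // f; apply: Finj; rewrite preK.
Qed.

Section FullyFaithful.
Variables (F : functor C D) (F_ff : fully_faithful F).

Lemma fully_faithful_inj (a b : C) : injective (fun f : hom a b => fmap F f).
Proof. exact: bij_inj (F_ff a b). Qed.

Lemma fully_faithful_surj (a b : C) (u : hom (F a) (F b)) :
  exists f : hom a b, fmap F f == u.
Proof. by case: (F_ff a b) => g _ gK; exists (g u); rewrite gK. Qed.

Definition fpre (a b : C) (u : hom (F a) (F b)) : hom a b :=
  xchoose (fully_faithful_surj u).

Lemma fpreK (a b : C) (u : hom (F a) (F b)) : fmap F (fpre u) = u.
Proof. exact/eqP/(xchooseP (fully_faithful_surj u)). Qed.

Lemma fmapK (a b : C) (f : hom a b) : fpre (fmap F f) = f.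
Proof. by apply: fully_faithful_inj; rewrite /= fpreK. Qed.

Section RightInverse.
Variables (Q : functor D C) (eps : forall d : D, hom (F (Q d)) d).
Hypothesis eps_nat : forall (d d' : D) (v : hom d d'),
  eps d' \oc fmap F (fmap Q v) = v \oc eps d.
Hypothesis eps_iso : forall d : D, is_iso (eps d).

Lemma inv_eps_natural (d d' : D) (v : hom d d') :
  inv (eps_iso d') \oc v = fmap F (fmap Q v) \oc inv (eps_iso d).
Proof.
apply: (iso_compI (eps_iso d)); apply: (iso_Icomp (eps_iso d')).
by rewrite -!compA inv_comp compm1 -eps_nat !compA comp_inv comp1m.
Qed.

(** The isomorphism [Q F a -> a] is the one that [F] sends to [eps (F a)]. *)
Lemma right_inverse_quasi_inverse : quasi_inverse F Q.
Proof.
split; last by exists eps; split=> // d d' v; apply: eps_nat.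
exists (fun a => fpre (eps (F a))); split=> [a b f|a] /=.
  by apply: fully_faithful_inj; rewrite /= !fmapM !fpreK eps_nat.
exists (fpre (inv (eps_iso (F a)))).
by split; apply: fully_faithful_inj;
   rewrite /= fmapM !fpreK fmap1 ?inv_comp ?comp_inv.
Qed.

Lemma right_inverse_left_adjoint : adjoint Q F.
Proof.
exists (fun d a f => fmap F f \oc inv (eps_iso d));
  split=> [d a|d d' a a' u v f].
  exists (fun g => fpre (g \oc eps d)) => [f|g].
    by rewrite -compA inv_comp compm1 fmapK.
  by rewrite fpreK -compA comp_inv compm1.
by rewrite !fmapM -!compA inv_eps_natural.
Qed.

Lemma right_inverse_right_adjoint : adjoint F Q.
Proof.
exists (fun a d f => fpre (inv (eps_iso d) \oc f));
  split=> [a d|a a' d d' u v f].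
  exists (fun g => eps d \oc fmap F g) => [f|g].
    by rewrite fpreK compA comp_inv comp1m.
  by rewrite compA inv_comp comp1m fmapK.
apply: fully_faithful_inj.
by rewrite /= !fmapM !fpreK !compA inv_eps_natural.
Qed.

End RightInverse.

Lemma equivalence_adjoints :
  is_equivalence F -> exists2 Q : functor D C, adjoint Q F & adjoint F Q.
Proof.
case=> Q [_ [eps [eps_nat eps_iso]]]; exists Q.
  exact: (right_inverse_left_adjoint (eps := eps) eps_nat eps_iso).
exact: (right_inverse_right_adjoint (eps := eps) eps_nat eps_iso).
Qed.

End FullyFaithful.

(** The counit [eps] of an adjunction with left adjoint [F], given by its
    universal property. *)
Lemma adjoint_counit (F : functor C D) (H : functor D C) : adjoint F H ->
  exists eps : forall d : D, hom (F (H d)) d,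
    (forall (d d' : D) (v : hom d d'),
       eps d' \oc fmap F (fmap H v) = v \oc eps d) /\
    (forall (c : C) (d : D),
       bijective (fun g : hom c (H d) => eps d \oc fmap F g)).
Proof.
case=> phi [phi_bij phi_nat].
have surj d : exists e : hom (F (H d)) d, phi _ _ e == idm (H d).
  by case: (phi_bij (H d) d) => psi _ psiK; exists (psi (idm _)); rewrite psiK.
pose eps d := xchoose (surj d).
have phi_eps d : phi _ _ (eps d) = idm (H d) := eqP (xchooseP (surj d)).
have phi_comp c d (g : hom c (H d)) : phi _ _ (eps d \oc fmap F g) = g.
  have := phi_nat _ _ _ _ g (idm d) (eps d).
  by rewrite fmap1 !comp1m phi_eps comp1m.
exists eps; split=> [d d' v|c d].
  apply: (bij_inj (phi_bij _ _)); rewrite phi_comp.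
  have := phi_nat _ _ _ _ (idm (H d)) v (eps d).
  by rewrite fmap1 !compm1 phi_eps compm1 => ->.
by exists (phi c d) => // f; apply: (bij_inj (phi_bij _ _)); rewrite phi_comp.
Qed.

Lemma adjoint_hom_trivial (L : functor C D) (R : functor D C) (c : C) (d : D) :
  adjoint L R ->
  (forall f : hom (L c) d, f = 0) <-> (forall g : hom c (R d), g = 0).
Proof.
case=> phi [/(_ c d) [psi phiK psiK] _]; split=> triv x.
  by rewrite -(psiK x) -(psiK 0) (triv (psi x)) (triv (psi 0)).
by rewrite -(phiK x) -(phiK 0) (triv (phi _ _ x)) (triv (phi _ _ 0)).
Qed.

End FunctorTheory.

(** * Distinguished triangles *)

Section Triangles.
Variable A : triangulated.

Lemma shift_ff : fully_faithful (@shift A).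
Proof. exact: quasi_inverse_fully_faithful (shift_autoequivalence A). Qed.

Lemma fmap_shift_eq0 (a b : A) (f : hom a b) : fmap shift f = 0 -> f = 0.
Proof.
move=> Tf0; apply: (fully_faithful_inj shift_ff).
by rewrite /= Tf0 additive_functor0 //; apply: shift_additive.
Qed.

Lemma shift_shiftV (a : A) : isomorphic (shift (shiftV a)) a.
Proof.
by case: (shift_autoequivalence A) => _ [eps [_ eps_iso]]; exists (eps a);
   apply: eps_iso.
Qed.

Lemma shiftV_shift (a : A) : isomorphic (shiftV (shift a)) a.
Proof.
by case: (shift_autoequivalence A) => [[eta [_ eta_iso]] _]; exists (eta a);
   apply: eta_iso.
Qed.

Section Triangle.
Variables (a b c : A) (f : hom a b) (g : hom b c) (h : hom c (shift a)).
Hypothesis fgh : dist f g h.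

(** The pair [(idm a, f)] extends to a map to this triangle from
    [a -> a -> 0 -> shift a], so [g f] factors through [zero]. *)
Lemma dist_comp0 : g \oc f = 0.
Proof.
have [w [<- _]] := @dist_morphism _ _ _ _ _ _ _ _ _ _ _ _ _ (idm a) f
  (dist_id a) fgh erefl.
by rewrite compm0.
Qed.

(** Exactness of [hom x -] at [b], from the completion of a map of triangles
    out of [x -> 0 -> shift x]. *)
Lemma dist_lift (x : A) (k : hom x b) : g \oc k = 0 ->
  exists l : hom x a, k = f \oc l.
Proof.
move=> gk0.
have x_tri := (dist_rotate _ _ _).1 (dist_id x).
have ghf := (dist_rotate _ _ _).1 fgh.
have [|w [_]] := @dist_morphism _ _ _ _ _ _ _ _ _ _ _ _ _ k 0 x_tri ghf.
  by rewrite gk0 comp0m.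
rewrite fmap1 compmN compm1 compNm => /oppr_inj Tk.
exists (fpre shift_ff w); apply: (fully_faithful_inj shift_ff).
by rewrite /= fmapM fpreK.
Qed.

End Triangle.

Section TriangleRotated.
Variables (a b c : A) (f : hom a b) (g : hom b c) (h : hom c (shift a)).
Hypothesis fgh : dist f g h.

Let ghf : dist g h (- fmap shift f) := (dist_rotate _ _ _).1 fgh.
Let hfg : dist h (- fmap shift f) (- fmap shift g) := (dist_rotate _ _ _).1 ghf.

Lemma dist_lift2 (x : A) (k : hom x c) : h \oc k = 0 ->
  exists l : hom x b, k = g \oc l.
Proof. exact: (dist_lift ghf). Qed.

Lemma dist_comp0_shift : fmap shift f \oc h = 0.
Proof.
by have /eqP := dist_comp0 hfg; rewrite compNm oppr_eq0 => /eqP.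
Qed.

(** A map killed by [f] has its translate lifting along [h]. *)
Lemma dist_mono : h = 0 -> forall (x : A) (k : hom x a), f \oc k = 0 -> k = 0.
Proof.
move=> h0 x k fk0; apply: fmap_shift_eq0.
have [|l ->] := @dist_lift _ _ _ _ _ _ hfg _ (fmap shift k).
  rewrite compNm -fmapM fk0 additive_functor0 ?oppr0 //.
  exact: shift_additive.
by rewrite h0 comp0m.
Qed.

(** The section [s] of [g] comes from lifting [idm c]; the projection [p] is
    the lift along [f] of the complementary idempotent [idm b - s g]. *)
Lemma split_triangle : h = 0 ->
  exists (s : hom c b) (p : hom b a),
    [/\ p \oc f = idm a, g \oc s = idm c, g \oc f = 0, p \oc s = 0
      & f \oc p + s \oc g = idm b].
Proof.
move=> h0; have f_mono := dist_mono h0; have gf := dist_comp0 fgh.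
have [|s gs] := @dist_lift2 c (idm c); first by rewrite h0 comp0m.
have [|p fp] := @dist_lift _ _ _ _ _ _ fgh b (idm b - s \oc g).
  by rewrite compDr compmN compm1 compA -gs comp1m subrr.
exists s, p; split; rewrite -?fp ?subrK //.
- apply/eqP; rewrite -subr_eq0; apply/eqP/f_mono.
  by rewrite compDr compmN compm1 compA -fp compDl compNm comp1m -compA gf
             compm0 subr0 subrr.
- apply: f_mono.
  by rewrite compA -fp compDl compNm comp1m -compA -gs compm1 subrr.
Qed.

End TriangleRotated.
End Triangles.

(** * The essential image of an exact functor and its right orthogonal *)

Section EssentialImage.
Variables (A B : triangulated) (F : functor A B).
Hypotheses (F_ff : fully_faithful F) (F_exact : exact_functor F).

Definition ess_image (b : B) : Prop := exists a : A, isomorphic (F a) b.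

Definition right_orthogonal (c : B) : Prop :=
  forall (a : A) (k : hom (F a) c), k = 0.

Lemma exact_shift (a : A) : isomorphic (F (shift a)) (shift (F a)).
Proof.
by case: F_exact => _ [alpha [[_ alpha_iso] _]]; exists (alpha a);
   apply: alpha_iso.
Qed.

Lemma ess_image_fob (a : A) : ess_image (F a).
Proof. by exists a, (idm _), (idm _); rewrite compm1. Qed.

Lemma ess_image_shift (b : B) : ess_image b -> ess_image (shift b).
Proof.
case=> a ab; exists (shift a).
exact: isomorphic_trans (exact_shift a) (fmap_isomorphic shift ab).
Qed.

(** Up to isomorphism, [F a = F (shift (shiftV a)) = shift (F (shiftV a))]. *)
Lemma ess_image_unshift (b : B) : ess_image b ->
  exists a : A, isomorphic (shift (F a)) b.
Proof.
case=> a ab; exists (shiftV a); apply: isomorphic_trans ab.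
apply: isomorphic_trans (fmap_isomorphic F (shift_shiftV a)).
exact: isomorphic_sym (exact_shift _).
Qed.

Lemma ess_image_shiftV (b : B) : ess_image b -> ess_image (shiftV b).
Proof.
case/ess_image_unshift=> a ab; exists a.
apply: isomorphic_trans (fmap_isomorphic shiftV ab).
exact: isomorphic_sym (shiftV_shift _).
Qed.

Lemma ess_image_shiftz (i : int) (b : B) :
  ess_image b -> ess_image (shiftz i b).
Proof.
move=> bF; case: i => n.
  by elim: n => //= n; apply: ess_image_shift.
rewrite /shiftz; elim: n.+1 => //= m; exact: ess_image_shiftV.
Qed.

Lemma hom_from_ess_image (b c : B) :
  ess_image b -> right_orthogonal c -> forall k : hom b c, k = 0.
Proof.
case=> a [f f_iso] c0 k; apply: (iso_compI f_iso).
by rewrite comp0m; apply: c0.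
Qed.

Lemma right_orthogonal_iso (c c' : B) :
  isomorphic c c' -> right_orthogonal c -> right_orthogonal c'.
Proof.
case/isomorphic_sym=> f f_iso c0 a k; apply: (iso_Icomp f_iso).
by rewrite compm0; apply: c0.
Qed.

(** Up to isomorphism [F a = shift (F a')] for some [a'], so a map
    [F a -> shift c] is the translate of a map [F a' -> c]. *)
Lemma right_orthogonal_shift (c : B) :
  right_orthogonal c -> right_orthogonal (shift c).
Proof.
move=> c0 a k.
have [a' [f f_iso]] := ess_image_unshift (ess_image_fob a).
apply: (iso_compI f_iso); rewrite comp0m -(fpreK (@shift_ff B) (k \oc f)).
by rewrite (c0 _ (fpre _ _)) additive_functor0 //; apply: shift_additive.
Qed.

Lemma right_orthogonal_shiftV (c : B) :
  right_orthogonal c -> right_orthogonal (shiftV c).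
Proof.
move=> c0 a k; apply: fmap_shift_eq0; apply: hom_from_ess_image.
  by exists (shift a); apply: exact_shift.
exact: right_orthogonal_iso (isomorphic_sym (shift_shiftV c)) c0.
Qed.

Lemma right_orthogonal_shiftz (i : int) (c : B) :
  right_orthogonal c -> right_orthogonal (shiftz i c).
Proof.
move=> c0; case: i => n.
  by elim: n => //= n; apply: right_orthogonal_shift.
rewrite /shiftz; elim: n.+1 => //= m; exact: right_orthogonal_shiftV.
Qed.

(** If postcomposition with [eps] is bijective on maps from the image of [F],
    then so is postcomposition with its translate, and the long exact sequence
    of [hom (F a) -] leaves nothing for the cone. *)
Lemma cone_counit_right_orthogonal (x : A) (b c : B)
    (eps : hom (F x) b) (g : hom b c) (h : hom c (shift (F x))) :
  (forall a : A, bijective (fun u : hom a x => eps \oc fmap F u)) ->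
  dist eps g h -> right_orthogonal c.
Proof.
move=> eps_bij tri a k.
have F0 a' : eps \oc fmap F (0 : hom a' x) = 0.
  by rewrite additive_functor0 ?compm0 //; case: F_exact.
have hk0 : h \oc k = 0.
  (* Up to isomorphism [F a = shift (F a')], and [h k] becomes the translate
     of a map [l : F a' -> F x] that [eps] kills; as [l] is in the image of
     [F], it is zero. *)
  have [a' [f f_iso]] := ess_image_unshift (ess_image_fob a).
  apply: (iso_compI f_iso).
  rewrite comp0m -(fpreK (@shift_ff B) (h \oc k \oc f)).
  set l := fpre _ _.
  have epsl : eps \oc l = 0.
    apply: fmap_shift_eq0.
    by rewrite fmapM fpreK !compA (dist_comp0_shift tri) !comp0m.
  have : fpre F_ff l = 0.
    by apply: (bij_inj (eps_bij a')); rewrite /= fpreK epsl F0.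
  move=> /(congr1 (fmap F)); rewrite fpreK => ->.
  rewrite !additive_functor0 //; first exact: shift_additive.
  by case: F_exact.
(* So [k] lifts to [b], hence to [F x], and the composite of two consecutive
   maps of the triangle is zero. *)
have [l ->] := dist_lift2 tri hk0.
have [u _ uK] := eps_bij a.
by rewrite -(uK l) compA (dist_comp0 tri) comp0m.
Qed.

(** The essential image of [F] and its right orthogonal play the roles of the
    two subcategories in the definition of indecomposability; the hypothesis on
    [G] and [H] makes the orthogonality two-sided. *)
Lemma indecomposable_adjoints_equivalence (G H : functor B A) :
  indecomposable B -> ~ (forall a : A, isomorphic a zero) ->
  adjoint G F -> adjoint F H ->
  (forall b : B, isomorphic (H b) zero -> isomorphic (G b) zero) ->
  is_equivalence F.
Proof.
move=> B_indec A_nonzero adjGF adjFH HG0.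
have [eps [eps_nat eps_bij]] := adjoint_counit adjFH.
have hom_to_ess_image c b : right_orthogonal c -> ess_image b ->
    forall k : hom c b, k = 0.
  move=> c0 [a [f [f' [_ ff']]]] k.
  (* [hom (H c) (H c)] is [hom (F (H c)) c], so [idm (H c) = 0]. *)
  have /HG0/isomorphic_zero Gc0 : isomorphic (H c) zero.
    apply/isomorphic_zero; apply: (adjoint_hom_trivial _ _ adjFH).1.
    exact: c0.
  have triv : forall l : hom c (F a), l = 0.
    by apply: (adjoint_hom_trivial _ _ adjGF).1 => l; apply: null_source.
  by rewrite -(comp1m k) -ff' -compA (triv (f' \oc k)) compm0.
have split b : exists (c : B) (g : hom b c) (s : hom c b)
    (p : hom b (F (H b))), right_orthogonal c /\
    [/\ p \oc eps b = idm _, g \oc s = idm c, g \oc eps b = 0, p \oc s = 0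
      & eps b \oc p + s \oc g = idm b].
  have [c [g [h tri]]] := dist_complete (eps b).
  have c0 : right_orthogonal c.
    exact: cone_counit_right_orthogonal (fun a => eps_bij a b) tri.
  have h0 : h = 0.
    apply: hom_to_ess_image => //; exists (shift (H b)); exact: exact_shift.
  by have [s [p spl]] := split_triangle tri h0; exists c, g, s, p.
have [b|b c bF c0 i|im0|orth0] := B_indec ess_image right_orthogonal.
- have [c [g [s [p [c0 [pe gs ge ps sum]]]]]] := split b.
  exists (F (H b)), c; split=> //; first exact: ess_image_fob.
  by exists (eps b), s, p, g.
- split=> k; first exact: (hom_from_ess_image bF (right_orthogonal_shiftz c0)).
  exact: (hom_to_ess_image _ _ c0 (ess_image_shiftz i bF)).
- case: A_nonzero => a; apply/isomorphic_zero.
  apply: (fully_faithful_inj F_ff); rewrite /= fmap1.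
  rewrite additive_functor0; last by case: F_exact.
  by apply/isomorphic_zero/im0/ess_image_fob.
- have eps_iso b : is_iso (eps b).
    have [c [g [s [p [c0 [pe _ _ _ sum]]]]]] := split b.
    have /isomorphic_zero idc0 := orth0 c c0.
    by exists p; rewrite -sum (null_source s idc0) comp0m addr0.
  by exists H; apply: right_inverse_quasi_inverse eps_nat eps_iso.
Qed.

End EssentialImage.

Theorem theorem3p3 (A B : triangulated) (F : functor A B)
    (F_ff : fully_faithful F) (F_exact : exact_functor F)
    (B_indec : indecomposable B)
    (A_nonzero : ~ (forall a : A, isomorphic a zero)) :
  is_equivalence F <->
  exists G H : functor B A,
    [/\ adjoint G F, adjoint F H
      & forall b : B, isomorphic (H b) zero -> isomorphic (G b) zero].
Proof.
split=> [/(equivalence_adjoints F_ff) [Q QF FQ]|[G [H [GF FH HG0]]]].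
  by exists Q, Q.
exact: indecomposable_adjoints_equivalence GF FH HG0.
Qed.
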